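(* Let $q=q_1\cdots q_k$ be an indecomposable pattern of length $k$, let $L=\lim_{n\to\infty}\sqrt[n]{S_n(q)}$, and let $q'=1\,(q_1+1)(q_2+1)\cdots(q_k+1)$ be the pattern of length $k+1$ obtained by adding 1 to each entry of $q$ and prepending the entry 1. Then $\lim_{n\to\infty}\sqrt[n]{S_n(q')}\ge 1+L+2\sqrt{L}$.
   Context: A permutation $p=p_1\cdots p_n$ of $[n]$ contains a pattern $q$ (a permutation of $[k]$) if there are indices $i_1<\dots<i_k$ with $p_{i_a}<p_{i_b}$ iff $q_a<q_b$; otherwise $p$ avoids $q$. $S_n(q)$ is the number of permutations of length $n$ avoiding $q$; the limit $\lim_{n\to\infty}\sqrt[n]{S_n(q)}$ is known to exist for every pattern. A pattern $q$ is decomposable if there is $1\le j<k$ such that every entry among $q_1,\dots,q_j$ is larger than every entry among $q_{j+1},\dots,q_k$; otherwise it is indecomposable. *)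

(* Defs.v *)
From mathcomp Require Import all_boot all_order all_fingroup all_algebra.
From mathcomp Require Import all_classical all_reals all_analysis.

Set Implicit Arguments.
Unset Strict Implicit.
Unset Printing Implicit Defensive.

(* A permutation p_1 ... p_n of [n] is represented by p : 'S_n with positions
   and values both shifted down by one: p_(i+1) = p i + 1. *)

Definition contains (n k : nat) (p : 'S_n) (q : 'S_k) : bool :=
  [exists f : {ffun 'I_k -> 'I_n},
    [forall a : 'I_k, forall b : 'I_k, (a < b) ==> (f a < f b)] &&
    [forall a : 'I_k, forall b : 'I_k, (p (f a) < p (f b)) == (q a < q b)]].

Definition avoids (n k : nat) (p : 'S_n) (q : 'S_k) : bool := ~~ contains p q.

(* S_n(q) *)
Definition nb_avoiders (k : nat) (q : 'S_k) (n : nat) : nat :=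
  #|[set p : 'S_n | avoids p q]|.

(* j is the length of the initial segment, so it ranges over 1 <= j < k. *)
Definition decomposable (k : nat) (q : 'S_k) : bool :=
  [exists j : 'I_k, (0 < j) &&
    [forall a : 'I_k, forall b : 'I_k, (a < j <= b) ==> (q b < q a)]].

Definition indecomposable (k : nat) (q : 'S_k) : bool := ~~ decomposable q.

(* 1 (q_1 + 1) ... (q_k + 1): lift_perm ord0 ord0 q sends position 0 to value 0
   and position i + 1 to value q i + 1. *)
Definition prepend1 (k : nat) (q : 'S_k) : 'S_k.+1 := lift_perm ord0 ord0 q.

(* The term at n = 0 has exponent 0^-1 = 0 and is irrelevant to the limit. *)
Definition root_avoiders (R : realType) (k : nat) (q : 'S_k) (n : nat) : R :=
  ((nb_avoiders q n)%:R `^ (n%:R^-1))%R.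

(* Main.v *)
(* Upper bound. The Marcus-Tardos block argument bounds the number of points of a
   pattern-avoiding subset of the n x n grid by a multiple of n when n is a power of
   k ^ 2, and Klazar's refinement count turns this into an exponential bound on the
   number of such subsets. As q' = prepend1 q is always indecomposable, its avoiders are
   closed under skew sums, so Fekete's lemma gives a finite limit G.

   Lower bound. Let T_m be the number of q-avoiding partial permutations of [m], so
   T_m >= 'C(m, s) ^ 2 * S_s(q) for all s. Place r of them along a descending
   antidiagonal of m x m blocks, leaving one extra block of columns empty on the left
   and one extra block of rows empty at the bottom, and match the free columns with
   the free rows decreasingly. The extra blocks push every added entry below the
   antidiagonal, so all of them are left-to-right minima; none can then be
   part of the q in a copy of q', and indecomposability of q confines that q
   to a single block, which is impossible. Hence T_m ^ r <= S_{(r+1)m}(q'), so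
   G ^ m >= T_m >= 'C(m, s) ^ 2 * S_s(q), and the binomial expansion of
   (1 + sqrt L) ^ m yields sqrt G >= 1 + sqrt L. *)

Require Import Defs.
From mathcomp Require Import all_boot all_order all_fingroup all_algebra.
From mathcomp Require Import all_classical all_reals all_analysis.
From mathcomp Require Import ring lra zify.
Import Order.TTheory GRing.Theory Num.Theory.
Import numFieldNormedType.Exports.

Set Implicit Arguments.
Unset Strict Implicit.
Unset Printing Implicit Defensive.

Local Open Scope nat_scope.

(** * Linear bound for pattern-avoiding point sets *)

(** The set [A] may hold several points in a row or column. As [q] is injective, the last condition
    still puts the points of a copy in distinct rows. *)
Definition has_pattern (n k : nat) (q : 'S_k) (A : {set 'I_n * 'I_n}) : Prop :=
  exists z : 'I_k -> 'I_n * 'I_n,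
    [/\ forall a, z a \in A,
        forall a b : 'I_k, a < b -> (z a).1 < (z b).1 &
        forall a b : 'I_k, ((z a).2 < (z b).2) = (q a < q b)].

Definition graph (n : nat) (p : 'S_n) : {set 'I_n * 'I_n} :=
  [set (i, p i) | i in 'I_n].

Lemma mem_graph (n : nat) (p : 'S_n) (z : 'I_n * 'I_n) :
  (z \in graph p) = (p z.1 == z.2).
Proof.
apply/imsetP/eqP => [[i _ ->] //|pz]; exists z.1 => //.
by rewrite pz -surjective_pairing.
Qed.

Lemma graph_inj (n : nat) : injective (@graph n).
Proof.
move=> p p' pp'; apply/permP => i.
have : (i, p i) \in graph p' by rewrite -pp' mem_graph.
by rewrite mem_graph => /eqP.
Qed.

Lemma containsP (n k : nat) (p : 'S_n) (q : 'S_k) :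
  reflect (has_pattern q (graph p)) (contains p q).
Proof.
apply: (iffP existsP) => [[f /andP[/forallP f1 /forallP f2]]|[z [z1 z2 z3]]].
  exists (fun a => (f a, p (f a))); split => [a|a b ab|a b] /=.
  - by rewrite mem_graph.
  - by have /forallP/(_ b)/implyP := f1 a; exact.
  - by have /forallP/(_ b)/eqP := f2 a.
exists [ffun a => (z a).1]; apply/andP; split; apply/forallP => a;
  apply/forallP => b; rewrite !ffunE; first by apply/implyP/z2.
have /eqP-> : p (z a).1 == (z a).2 by rewrite -mem_graph.
have /eqP-> : p (z b).1 == (z b).2 by rewrite -mem_graph.
by rewrite z3.
Qed.

Definition transpose (n : nat) (A : {set 'I_n * 'I_n}) : {set 'I_n * 'I_n} :=
  [set z | (z.2, z.1) \in A].

(** Transposition swaps positions and values, so it inverts the pattern; reindexing a copy by [q]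
    lists its points by column again. *)
Lemma has_pattern_transpose (n k : nat) (q : 'S_k) (A : {set 'I_n * 'I_n}) :
  has_pattern q^-1%g (transpose A) -> has_pattern q A.
Proof.
case=> z [z1 z2 z3]; exists (fun a => ((z (q a)).2, (z (q a)).1)); split => /=.
- by move=> a; have := z1 (q a); rewrite inE.
- by move=> a b ab; rewrite z3 !permK.
- move=> a b; case: (ltngtP (q a) (q b)) => [/z2 //|/z2|/val_inj ->].
  + by move=> h; apply/negbTE; rewrite -leqNgt ltnW.
  + by rewrite ltnn.
Qed.

Lemma increasing_selection (n k : nat) (S : {set 'I_n}) : k <= #|S| ->
  exists2 f : 'I_k -> 'I_n, (forall a, f a \in S) &
    forall a b : 'I_k, a < b -> f a < f b.
Proof.
move=> kS; exists (fun a => enum_val (widen_ord kS a)) => [a|a b ab].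
  exact: enum_valP.
have srt : sorted ltn (map val (enum S)).
  apply: (subseq_sorted ltn_trans _ (iota_ltn_sorted 0 n)).
  by rewrite -val_enum_ord map_subseq // enumT; exact: filter_subseq.
have i0 : 'I_n := enum_val (widen_ord kS a).
have lt_S (c : 'I_k) : c < size (enum S).
  by rewrite -cardE; exact: leq_trans kS.
have e (c : 'I_k) : val (enum_val (widen_ord kS c)) = nth (val i0) (map val (enum S)) c.
  by rewrite (nth_map i0) // (enum_val_nth i0).
by rewrite !e (sorted_ltn_nth ltn_trans) // inE size_map.
Qed.

Lemma card_fiber_bound (T T' : finType) (S : {set T}) (f : T -> T') (b : nat) :
  (forall y, #|[set x in S | f x == y]| <= b) -> #|S| <= #|T'| * b.
Proof.
move=> Hb; rewrite -sum1_card (partition_big f predT) //=.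
rewrite -sum_nat_const; apply: leq_sum => y _.
by apply: leq_trans (Hb y); rewrite -sum1_card; under [leqRHS]eq_bigl do rewrite inE.
Qed.

(** * Contraction of the grid into square blocks *)

Section Blocks.
Variables (n K : nat).

Lemma block_size_gt0 (i : 'I_(n * K)) : 0 < K.
Proof.
by have := leq_ltn_trans (leq0n i) (ltn_ord i); rewrite muln_gt0 => /andP[].
Qed.

Lemma block_subproof (i : 'I_(n * K)) : i %/ K < n.
Proof. by rewrite ltn_divLR // (block_size_gt0 i). Qed.

Lemma residue_subproof (i : 'I_(n * K)) : i %% K < K.
Proof. by rewrite ltn_mod (block_size_gt0 i). Qed.

Definition block (i : 'I_(n * K)) : 'I_n := Ordinal (block_subproof i).
Definition residue (i : 'I_(n * K)) : 'I_K := Ordinal (residue_subproof i).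

Lemma block_residue_inj (i j : 'I_(n * K)) :
  block i = block j -> residue i = residue j -> i = j.
Proof.
move=> [bij] [rij]; apply: val_inj => /=.
by rewrite (divn_eq i K) (divn_eq j K) bij rij.
Qed.

Lemma ltn_block (i j : 'I_(n * K)) : block i < block j -> i < j.
Proof. by rewrite /= !ltnNge; apply: contra; exact: leq_div2r. Qed.

Definition cell_of (z : 'I_(n * K) * 'I_(n * K)) : 'I_n * 'I_n :=
  (block z.1, block z.2).

Definition cells (A : {set 'I_(n * K) * 'I_(n * K)}) : {set 'I_n * 'I_n} :=
  cell_of @: A.

Definition in_cell (A : {set 'I_(n * K) * 'I_(n * K)}) (c : 'I_n * 'I_n) :=
  [set z in A | cell_of z == c].

(** By injectivity of [q], distinct indices fall in distinct blocks, and there blocks and points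
    compare alike. *)
Lemma ltn_block_pattern (k : nat) (q : 'S_k) (g : 'I_k -> 'I_(n * K)) :
  (forall a b : 'I_k, (block (g a) < block (g b)) = (q a < q b)) ->
  forall a b : 'I_k, (g a < g b) = (q a < q b).
Proof.
move=> gq a b; case: (ltngtP (q a) (q b)) => [|qba|/val_inj/perm_inj ->].
- by rewrite -gq => /ltn_block.
- by apply/negbTE; rewrite -leqNgt ltnW // ltn_block // gq.
- by rewrite ltnn.
Qed.

(** Any choice of one point of [A] in each cell of the copy works. Hence contraction preserves
    avoidance. *)
Lemma has_pattern_cells (k : nat) (q : 'S_k) (A : {set 'I_(n * K) * 'I_(n * K)}) :
  has_pattern q (cells A) -> has_pattern q A.
Proof.
case=> c [c1 c2 c3].
have /fin_all_exists[z zP] a : exists z, z \in A /\ c a = cell_of z.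
  by have /imsetP[z zA cz] := c1 a; exists z.
exists z; split => [a|a b ab|].
- by case: (zP a).
- apply: ltn_block; have := c2 _ _ ab.
  by have [_ ->] := zP a; have [_ ->] := zP b.
- apply: ltn_block_pattern => a b; rewrite -c3.
  by have [_ ->] := zP a; have [_ ->] := zP b.
Qed.

Lemma residues_inj (A : {set 'I_(n * K) * 'I_(n * K)}) c :
  {in in_cell A c &, injective (fun z => (residue z.1, residue z.2))}.
Proof.
move=> [x y] [x' y']; rewrite !inE /= => /andP[_ /eqP <-] /andP[_ /eqP].
move=> [bx by_] [rx ry]; congr pair; apply: block_residue_inj; apply: val_inj => //=;
  by rewrite ?bx ?by_.
Qed.

Lemma card_in_cell (A : {set 'I_(n * K) * 'I_(n * K)}) c : #|in_cell A c| <= K ^ 2.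
Proof.
rewrite -(card_in_imset (@residues_inj A c)); apply: leq_trans (max_card _) _.
by rewrite card_prod card_ord.
Qed.

Lemma card_cells_sum (A : {set 'I_(n * K) * 'I_(n * K)}) :
  #|A| = \sum_(c in cells A) #|in_cell A c|.
Proof.
rewrite -sum1_card (partition_big cell_of (mem (cells A))) /=; last first.
  by move=> z zA; exact: imset_f.
apply: eq_bigr => c _; rewrite -sum1_card; apply: eq_bigl => z.
by rewrite inE.
Qed.

Definition columns (A : {set 'I_(n * K) * 'I_(n * K)}) (c : 'I_n * 'I_n) : {set 'I_K} :=
  [set residue z.1 | z in in_cell A c].

(** The tall cells of the Marcus-Tardos argument are obtained from this by transposing:
    [transpose (wide k (transpose A))]. *)
Definition wide (k : nat) (A : {set 'I_(n * K) * 'I_(n * K)}) : {set 'I_n * 'I_n} :=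
  [set c | k <= #|columns A c|].

(* [k] wide cells in one block column meeting the same set of residues would
   carry a copy of the pattern, one cell per row of the pattern. *)
Lemma card_wide (k : nat) (q : 'S_k) (A : {set 'I_(n * K) * 'I_(n * K)}) :
  ~ has_pattern q A -> #|wide k A| <= n * 2 ^ K * k.
Proof.
move=> Aq.
have -> : n * 2 ^ K = #|{: 'I_n * {set 'I_K}}|.
  by rewrite card_prod card_ord -cardsT -powersetT card_powerset cardsT card_ord.
apply: (card_fiber_bound (f := fun c => (c.1, columns A c))) => -[j S].
rewrite leqNgt; apply/negP => /ltnW kF; apply: Aq.
set F := [set c in _ | _] in kF.
have Fj c : c \in F -> [/\ c.1 = j, columns A c = S & k <= #|S|].
  by rewrite !inE => /andP[h /eqP[<- <-]].
have [rho rhoF rho_lt] : exists2 f : 'I_k -> 'I_n, (forall a, f a \in snd @: F) &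
    forall a b : 'I_k, a < b -> f a < f b.
  apply: increasing_selection; rewrite card_in_imset //.
  move=> [c c'] [d d'] /Fj[/= -> _ _] /Fj[/= -> _ _] /= -> //.
have {}rhoF a : (j, rho a) \in F.
  by have /imsetP[[c d] cF ->] := rhoF a; have [/= <- _ _] := Fj _ cF.
have [k0|k_gt0] := posnP k.
  have no (a : 'I_k) : False by case: a => a; rewrite {1}k0.
  by exists (fun a => False_rect _ (no a)); split => a; case: (no a).
have [_ _ kS] := Fj _ (rhoF (Ordinal k_gt0)).
have [sg sgS sg_lt] := increasing_selection kS.
have /fin_all_exists[z zP] (a : 'I_k) : exists z,
    [/\ z \in A, cell_of z = (j, rho (q a)) & residue z.1 = sg a].
  have [_ colS _] := Fj _ (rhoF (q a)).
  have := sgS a; rewrite -colS => /imsetP[z].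
  by rewrite inE => /andP[zA /eqP cz] ->; exists z.
exists z; split => [a|a b ab|].
- by case: (zP a).
- have [_ [za _] ra] := zP a; have [_ [zb _] rb] := zP b.
  rewrite (divn_eq (z a).1 K) (divn_eq (z b).1 K).
  have -> : (z a).1 %/ K = (z b).1 %/ K by rewrite -[LHS]/(val (block _)) za -zb.
  rewrite ltn_add2l -[_ %% _]/(val (residue _)) -[X in _ < X]/(val (residue _)) ra rb.
  exact: sg_lt.
- apply: ltn_block_pattern => a b.
  have [_ [_ za] _] := zP a; have [_ [_ zb] _] := zP b; rewrite za zb.
  case: (ltngtP (q a) (q b)) => [/rho_lt //|/rho_lt h|/val_inj ->].
  + by apply/negbTE; rewrite -leqNgt ltnW.
  + by rewrite ltnn.
Qed.

End Blocks.

Lemma columns_transpose (n K : nat) (A : {set 'I_(n * K) * 'I_(n * K)}) c :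
  columns (transpose A) (c.2, c.1) = [set residue z.2 | z in in_cell A c].
Proof.
apply/setP => x; apply/imsetP/imsetP => -[z]; rewrite !inE => /andP[zA /eqP cz] ->.
  exists (z.2, z.1) => //; rewrite !inE zA; move: cz; rewrite /cell_of => -[/= -> ->].
  by rewrite -surjective_pairing /=.
exists (z.2, z.1) => //; rewrite !inE /= -surjective_pairing zA -cz /=.
exact: eqxx.
Qed.

Lemma card_transpose (n : nat) (A : {set 'I_n * 'I_n}) : #|transpose A| = #|A|.
Proof.
rewrite -(card_imset A (f := fun z => (z.2, z.1))); last by move=> [? ?] [? ?] [-> ->].
congr #|pred_of_set _|; apply/setP => z; rewrite inE.
apply/idP/imsetP => [zA|[z' zA ->]]; last by rewrite -surjective_pairing.
by exists (z.2, z.1) => //=; rewrite -surjective_pairing.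
Qed.

(** Residues embed the cell in the product of its occupied columns and its occupied rows, fewer than
    [k] of each. *)
Lemma card_thin_cell (n K k : nat) (A : {set 'I_(n * K) * 'I_(n * K)}) c :
  c \notin wide k A -> c \notin transpose (wide k (transpose A)) ->
  #|in_cell A c| <= k.-1 ^ 2.
Proof.
rewrite !inE columns_transpose -!ltnNge /columns => w1 w2.
have sub : [set (residue z.1, residue z.2) | z in in_cell A c] \subset
    finset.setX [set residue z.1 | z in in_cell A c] [set residue z.2 | z in in_cell A c].
  by apply/fintype.subsetP => x /imsetP[z zA ->]; rewrite inE /=; apply/andP;
    split; apply/imsetP; exists z.
rewrite -(card_in_imset (@residues_inj _ _ A c)) (leq_trans (subset_leq_card sub)) // cardsX.
by rewrite expnS expn1 leq_mul // -ltnS (leq_trans w1, leq_trans w2) // leqSpred.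
Qed.

(** The Marcus-Tardos recursion: a thin cell holds at most [k.-1 ^ 2] points; a wide or tall one may
    hold [K ^ 2], but their number is linear in [n]. *)
Lemma card_avoider_blocks (n K k : nat) (q : 'S_k) (A : {set 'I_(n * K) * 'I_(n * K)}) :
  ~ has_pattern q A ->
  #|A| <= k.-1 ^ 2 * #|cells A| + K ^ 2 * (2 * (2 ^ K * k)) * n.
Proof.
move=> Aq.
pose W := wide k A; pose W' := transpose (wide k (transpose A)).
have cW : #|W| <= n * 2 ^ K * k by exact: card_wide Aq.
have cW' : #|W'| <= n * 2 ^ K * k.
  rewrite card_transpose; apply: (card_wide (q := q^-1%g)).
  by move/has_pattern_transpose.
rewrite card_cells_sum.
have -> : K ^ 2 * (2 * (2 ^ K * k)) * n = (n * 2 ^ K * k + n * 2 ^ K * k) * K ^ 2.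
  by ring.
apply: leq_trans (_ : \sum_(c in cells A) (k.-1 ^ 2 + (c \in W :|: W') * K ^ 2) <= _).
  apply: leq_sum => c _; rewrite inE.
  have [cW1|cW1] := boolP (c \in W).
    by rewrite mul1n (leq_trans (card_in_cell _ _)) // leq_addl.
  have [cW2|cW2] := boolP (c \in W').
    by rewrite mul1n (leq_trans (card_in_cell _ _)) // leq_addl.
  by rewrite mul0n addn0; apply: card_thin_cell.
rewrite big_split /= sum_nat_const mulnC leq_add2l -big_distrl /=.
rewrite leq_mul2r; apply/orP; right.
apply: leq_trans (_ : #|W :|: W'| <= _).
  rewrite -sum1_card [leqRHS](bigID (mem (cells A))) /=.
  apply: leq_trans (leq_addr _ _); rewrite [leqRHS]big_mkcondr [leqRHS]big_mkcond /=.
  rewrite big_mkcond; apply: leq_sum => c _ /=.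
  by case: ifP; case: (c \in W :|: W').
by rewrite (leq_trans (leq_card_setU _ _)) // leq_add.
Qed.

Lemma avoider_linear (k : nat) (q : 'S_k) : 0 < k ->
  exists c, forall e (A : {set 'I_((k ^ 2) ^ e) * 'I_((k ^ 2) ^ e)}),
    ~ has_pattern q A -> #|A| <= c * (k ^ 2) ^ e.
Proof.
(* With [K = k ^ 2] we have [k.-1 ^ 2 + 1 <= K], so the recursion reproduces the bound [c * n] when
   [c] is its own linear coefficient. *)
move=> k0; set K := k ^ 2; pose c := K ^ 2 * (2 * (2 ^ K * k)).
have c0 : 0 < c by rewrite !muln_gt0 !expn_gt0 k0.
exists c; elim=> [|e IH] A Aq.
  rewrite (leq_trans (max_card _)) // card_prod card_ord expn0 !muln1 //.
rewrite expnSr in A Aq *.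
apply: leq_trans (card_avoider_blocks Aq) _.
apply: leq_trans (_ : k.-1 ^ 2 * (c * K ^ e) + c * K ^ e <= _).
  by rewrite leq_add2r leq_mul // IH // => /has_pattern_cells.
rewrite -[X in _ + X]mul1n -mulnDl.
have -> : c * (K ^ e * K) = K * (c * K ^ e) by ring.
rewrite leq_mul2r; apply/orP; right.
rewrite /K -[in leqRHS](prednK k0) -[X in _ <= X ^ 2]addn1 sqrnD exp1n.
by rewrite leq_addr.
Qed.

(** * Exponential bound on the number of avoiding sets *)

Definition avoiding_sets (n k : nat) (q : 'S_k) : {set {set 'I_n * 'I_n}} :=
  [set A | `[< ~ has_pattern q A >]].

Lemma avoiding_setsP (n k : nat) (q : 'S_k) (A : {set 'I_n * 'I_n}) :
  reflect (~ has_pattern q A) (A \in avoiding_sets n q).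
Proof. by rewrite /avoiding_sets finset.in_set; exact: asboolP. Qed.

(** Such an [A] is a subset of the union of the cells in [B], which has at most [K ^ 2 * #|B|]
    points. *)
Lemma card_refinements (n K : nat) (B : {set 'I_n * 'I_n}) :
  #|[set A : {set 'I_(n * K) * 'I_(n * K)} | cells A == B]| <= 2 ^ (K ^ 2 * #|B|).
Proof.
pose U := [set z : 'I_(n * K) * 'I_(n * K) | cell_of z \in B].
apply: leq_trans (_ : #|powerset U| <= _).
  apply/subset_leq_card/fintype.subsetP => A; rewrite !inE => /eqP AB.
  by apply/fintype.subsetP => z zA; rewrite inE -AB; exact: imset_f.
rewrite card_powerset leq_exp2l // card_cells_sum [K ^ 2 * _]mulnC -sum_nat_const.
apply: leq_trans (_ : \sum_(c in cells U) K ^ 2 <= _).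
  by apply: leq_sum => c _; exact: card_in_cell.
rewrite [leqLHS]big_mkcond [leqRHS]big_mkcond; apply: leq_sum => c _.
case: ifP => // /imsetP[z]; rewrite inE => zB ->; by rewrite zB.
Qed.

(** Klazar's count: group the avoiding sets by their contraction, which avoids [q] and therefore has
    at most [f] cells to refine. *)
Lemma card_avoiding_sets_blocks (n K k f : nat) (q : 'S_k) :
  (forall A : {set 'I_n * 'I_n}, ~ has_pattern q A -> #|A| <= f) ->
  #|avoiding_sets (n * K) q| <= #|avoiding_sets n q| * 2 ^ (K ^ 2 * f).
Proof.
move=> hf; rewrite -[leqLHS]sum1_card.
rewrite (partition_big (@cells n K) (mem (avoiding_sets n q))) /=; last first.
  move=> A /avoiding_setsP Aq; apply/avoiding_setsP.
  by move=> /has_pattern_cells.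
rewrite -sum_nat_const; apply: leq_sum => B /avoiding_setsP Bq.
apply: leq_trans (_ : 2 ^ (K ^ 2 * #|B|) <= _); last first.
  by rewrite leq_exp2l // leq_mul2l hf // orbT.
apply: leq_trans (card_refinements K B).
rewrite sum1_card; apply/subset_leq_card/fintype.subsetP => A.
by rewrite unfold_in inE => /andP[].
Qed.

Lemma nb_avoiders_le_sets (n k : nat) (q : 'S_k) : nb_avoiders q n <= #|avoiding_sets n q|.
Proof.
rewrite /nb_avoiders -(card_imset _ (@graph_inj n)).
apply/subset_leq_card/fintype.subsetP => A /imsetP[p]; rewrite inE => pq ->.
by apply/avoiding_setsP => /containsP; exact/negP.
Qed.

Lemma nb_avoiders_exp_bound_pow (k : nat) (q : 'S_k) : 1 < k ->
  exists C, forall e, nb_avoiders q ((k ^ 2) ^ e) <= C ^ ((k ^ 2) ^ e).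
Proof.
move=> k1; have [c hc] := avoider_linear q (ltnW k1).
set K := k ^ 2 in hc *.
have K2 : 2 <= K by rewrite (leq_trans k1) // /K expnS expn1 leq_pmull // ltnW.
(* The induction on [e] needs [d + K ^ 2 * c <= d * K], which holds as [K >= 2]; the summand 1
   serves the one-point grid. *)
clearbody K; pose d := K ^ 2 * c + 1.
exists (2 ^ d) => e; apply: leq_trans (nb_avoiders_le_sets _ _) _.
elim: e => [|e IH].
  rewrite expn0 expn1 (leq_trans (max_card _)) // -cardsT -powersetT card_powerset
    cardsT card_prod card_ord.
  by rewrite leq_exp2l // /d addn1.
rewrite expnSr (leq_trans (card_avoiding_sets_blocks _ (hc e))) //.
apply: leq_trans (leq_mul IH (leqnn _)) _.
rewrite -!expnM -expnD leq_exp2l // mulnA -mulnDl.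
have -> : d * (K ^ e * K) = d * K * K ^ e by ring.
rewrite leq_mul2r; apply/orP; right.
by rewrite (leq_trans _ (leq_mul (leqnn d) K2)) // muln2 -addnn leq_add2l leq_addr.
Qed.

(** * Skew sums *)

(** At the first index whose label exceeds [h a], [q] would decompose. With [h] the number of a
    block in a descending arrangement, this confines a copy of [q] to one block. *)
Lemma indecomposable_const (k : nat) (q : 'S_k) (h : 'I_k -> nat) :
  indecomposable q -> (forall a b : 'I_k, a < b -> h a <= h b) ->
  (forall a b : 'I_k, h a < h b -> q b < q a) -> forall a b, h a = h b.
Proof.
move=> qI hmono hq; suff lt a b : ~~ (h a < h b).
  by move=> a b; apply/eqP; rewrite eqn_leq; apply/andP;
    split; rewrite leqNgt.
apply: contra qI => hab.
have hmono' (c d : 'I_k) : c <= d -> h c <= h d.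
  by rewrite leq_eqVlt => /orP[/eqP/val_inj -> //|/hmono].
case: (@arg_minnP _ b (fun c => h a < h c) val hab) => j haj jmin.
apply/existsP; exists j; apply/andP; split.
  apply: leq_ltn_trans (leq0n a) _; rewrite ltnNge.
  by apply/negP => /hmono'; rewrite leqNgt haj.
apply/forallP => c; apply/forallP => d; apply/implyP => /andP[cj jd].
apply: hq; apply: leq_trans (hmono' _ _ jd); apply: leq_ltn_trans haj.
by rewrite leqNgt; apply/negP => /jmin; rewrite leqNgt cj.
Qed.

Section SkewSum.
Variables (m n : nat) (p1 : 'S_m) (p2 : 'S_n).

Definition skew_fun (i : 'I_(m + n)) : 'I_(m + n) :=
  cast_ord (addnC n m)
    match fintype.split i with
    | inl x => rshift n (p1 x)
    | inr y => lshift m (p2 y)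
    end.

Lemma skew_fun_inj : injective skew_fun.
Proof.
move=> i j /cast_ord_inj; rewrite -[i]splitK -[j]splitK !unsplitK.
case: (fintype.split i) (fintype.split j) => x [] y /=.
- by move=> /rshift_inj/perm_inj ->.
- by move=> /eqP; rewrite eq_rlshift.
- by move=> /eqP; rewrite eq_lrshift.
- by move=> /lshift_inj/perm_inj ->.
Qed.

Definition skew_sum : 'S_(m + n) := perm skew_fun_inj.

Lemma skew_sum_lshift x : skew_sum (lshift n x) = n + p1 x :> nat.
Proof. by rewrite permE /skew_fun (unsplitK (inl x)). Qed.

Lemma skew_sum_rshift y : skew_sum (rshift m y) = p2 y :> nat.
Proof. by rewrite permE /skew_fun (unsplitK (inr y)). Qed.

(** The label [h] tells which summand holds an entry. The second summand lies to the right of and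
    below the first, so [h] is constant on a copy of [q], which then lives in [p1] or in [p2]. *)
Lemma skew_sum_avoids (k : nat) (q : 'S_k) : 0 < k -> indecomposable q ->
  avoids p1 q -> avoids p2 q -> avoids skew_sum q.
Proof.
move=> k0 qI p1q p2q; apply/containsP => -[z [z1 z2 z3]].
have zp a : (z a).2 = skew_sum (z a).1 by have := z1 a; rewrite mem_graph => /eqP.
pose h a := (m <= (z a).1) : nat.
have hC : forall a b, h a = h b.
  apply: (indecomposable_const qI) => [a b /z2|a b]; rewrite /h.
    by case: (leqP m (z a).1); case: (leqP m (z b).1) => //= zb za zab; lia.
  rewrite -z3 !zp.
  case: (split_ordP (z a).1) => x ->; case: (split_ordP (z b).1) => y -> /=;
    rewrite ?skew_sum_lshift ?skew_sum_rshift.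
  - by have := ltn_ord x; have := ltn_ord y; lia.
  - by have := ltn_ord (p2 y); lia.
  - by have := ltn_ord y; lia.
  - by lia.
case: (ltnP (z (Ordinal k0)).1 m) => z0.
  have /fin_all_exists[x xz] a : exists x, (z a).1 = lshift n x.
    case: (split_ordP (z a).1) => x xE; first by exists x.
    by have := hC a (Ordinal k0); rewrite /h xE /=; lia.
  move: p1q => /containsP; apply; exists (fun a => (x a, p1 (x a))); split => /=.
  - by move=> a; rewrite mem_graph.
  - by move=> a b /z2; rewrite !xz.
  - by move=> a b; rewrite -z3 !zp !xz !skew_sum_lshift ltn_add2l.
have /fin_all_exists[x xz] a : exists x, (z a).1 = rshift m x.
  case: (split_ordP (z a).1) => x xE; last by exists x.
  by have := hC a (Ordinal k0); rewrite /h xE /=; have := ltn_ord x; lia.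
move: p2q => /containsP; apply; exists (fun a => (x a, p2 (x a))); split => /=.
- by move=> a; rewrite mem_graph.
- by move=> a b /z2; rewrite !xz /= ltn_add2l.
- by move=> a b; rewrite -z3 !zp !xz !skew_sum_rshift.
Qed.

End SkewSum.

Lemma nb_avoiders_supermul (k : nat) (q : 'S_k) (m n : nat) :
  0 < k -> indecomposable q ->
  nb_avoiders q m * nb_avoiders q n <= nb_avoiders q (m + n).
Proof.
move=> k0 qI; rewrite /nb_avoiders -cardsX.
rewrite -(card_imset (f := fun pp => skew_sum pp.1 pp.2)); last first.
  move=> [p1 p2] [p1' p2'] /= e; congr pair; apply/permP => x; apply: val_inj.
    by apply: (@addnI n); rewrite -(skew_sum_lshift p1 p2) e skew_sum_lshift.
  by rewrite /= -(skew_sum_rshift p1 p2) e skew_sum_rshift.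
apply/subset_leq_card/fintype.subsetP => p /imsetP[[p1 p2]].
rewrite !inE /= => /andP[p1q p2q] ->.
exact: skew_sum_avoids.
Qed.

(** The decreasing permutation is an avoider: a copy of [q] in it would let the index itself serve
    as a label, forcing 0 = 1. *)
Lemma nb_avoiders_gt0 (k : nat) (q : 'S_k) (n : nat) :
  1 < k -> indecomposable q -> 0 < nb_avoiders q n.
Proof.
move=> k1 qI; apply/card_gt0P; exists (perm (@rev_ord_inj n)); rewrite inE.
apply/containsP => -[z [z1 z2 z3]].
suff /(_ (Ordinal (ltnW k1)) (Ordinal k1)) : forall a b : 'I_k, val a = val b by [].
apply: (indecomposable_const qI) => [a b|a b ab]; first exact: ltnW.
have zp c : (z c).2 = rev_ord (z c).1.
  by have := z1 c; rewrite mem_graph permE => /eqP.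
rewrite -z3 !zp /=; have := z2 _ _ ab.
by have := ltn_ord (z b).1; lia.
Qed.

(** A cut at [j] would need an entry below the leading one, which is the minimum. *)
Lemma prepend1_indecomposable (k : nat) (q : 'S_k) : indecomposable (prepend1 q).
Proof.
apply/existsP => -[j /andP[j0 /forallP/(_ ord0)/forallP/(_ j)]].
by rewrite j0 leqnn /prepend1 lift_perm_id ltn0.
Qed.

(** * Completions of chunks of partial permutations *)

(** Equality of the two tests says at once that no column and no row is used twice: [A] is a partial
    permutation. *)
Definition partial_inj (n : nat) (A : {set 'I_n * 'I_n}) : Prop :=
  {in A &, forall x y, (x.1 == y.1) = (x.2 == y.2)}.

Lemma partial_inj_fst (n : nat) (A : {set 'I_n * 'I_n}) :
  partial_inj A -> {in A &, injective fst}.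
Proof.
move=> Ai [x1 x2] [y1 y2] xA yA /= e; have := Ai _ _ xA yA.
by rewrite /= e eqxx => /esym/eqP ->.
Qed.

Lemma partial_inj_snd (n : nat) (A : {set 'I_n * 'I_n}) :
  partial_inj A -> {in A &, injective snd}.
Proof.
move=> Ai [x1 x2] [y1 y2] xA yA /= e; have := Ai _ _ xA yA.
by rewrite /= e eqxx => /eqP ->.
Qed.

(** Induction on the number of free columns: match the leftmost free column [i0] with the topmost
    free row [v0]. *)
Lemma decreasing_completion (n : nat) (A : {set 'I_n * 'I_n}) : partial_inj A ->
  exists p : 'S_n, {in A, forall z, p z.1 = z.2} /\
    forall i j : 'I_n, i < j -> i \notin fst @: A -> j \notin fst @: A -> p j < p i.
Proof.
have [d] := ubnP #|~: (fst @: A)|; elim: d A => // d IH A Ad Ai.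
have [full|[i1 i1A]] := set_0Vmem (~: (fst @: A)).
  have /fin_all_exists[g gA] (i : 'I_n) : exists v, (i, v) \in A.
    have : i \in fst @: A.
      by rewrite -[fst @: A]finset.setCK full finset.setC0 inE.
    by move=> /imsetP[[i' v] iA ->]; exists v.
  have gI : injective g.
    by move=> i j gij; have [] := partial_inj_snd Ai (gA i) (gA j) gij.
  exists (perm gI); split.
    move=> [i v] iA; rewrite permE.
    by have [] := partial_inj_fst Ai (gA i) iA erefl.
  move=> i j _ iA; case/negP: iA; apply/imsetP; exists (i, g i) => //; exact: gA.
have [i0 i0A i0min] := @arg_minnP _ i1 (fun i => i \notin fst @: A) val
  ltac:(by move: i1A; rewrite inE).
(* A free row exists because [A] occupies as many rows as columns. *)
have [v1 v1A] : exists v, v \notin snd @: A.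
  apply/existsP; rewrite -negb_forall; apply/negP => /forallP all_snd.
  have : #|fst @: A| < n.
    rewrite -[ltnRHS]card_ord -cardsT; apply: proper_card; apply/properP.
    by split; [exact: finset.subsetT | exists i0].
  rewrite (card_in_imset (partial_inj_fst Ai)) -(card_in_imset (partial_inj_snd Ai)).
  rewrite (_ : snd @: A = [set: 'I_n]) ?cardsT ?card_ord ?ltnn //.
  by apply/setP => v; rewrite inE all_snd.
have [v0 v0A v0max] := @arg_maxnP _ v1 (fun v => v \notin snd @: A) val v1A.
pose A' := (i0, v0) |: A.
have A'i : partial_inj A'.
  have ne z : z \in A -> (z.1 == i0) = false /\ (z.2 == v0) = false.
    by move=> zA; split; apply/negbTE; [apply: contraNneq i0A|apply: contraNneq v0A]
      => <-; exact: imset_f.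
  move=> x y; rewrite !inE => /orP[/eqP ->|xA] /orP[/eqP ->|yA] /=.
  - by rewrite !eqxx.
  - by rewrite eq_sym [RHS]eq_sym; have [-> ->] := ne _ yA.
  - by have [-> ->] := ne _ xA.
  - exact: Ai.
have fstA' : fst @: A' = i0 |: fst @: A by rewrite imsetU1.
have [|p [pA pdec]] := IH A' _ A'i.
  rewrite fstA' -ltnS (leq_trans _ Ad) // ltnS; apply: proper_card.
  apply/properP; split; first by apply/fintype.subsetP => i; rewrite !inE negb_or => /andP[].
  by exists i0; rewrite !inE ?eqxx.
have pi0 : p i0 = v0 by have := pA (i0, v0); apply; rewrite !inE eqxx.
have pnA j : j \notin fst @: A -> p j \notin snd @: A.
  apply: contra => /imsetP[z zA]; rewrite -(pA z) ?inE ?zA ?orbT //.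
  by move=> /perm_inj ->; exact: imset_f.
exists p; split; first by move=> z zA; apply: pA; rewrite inE zA orbT.
(* For [i = i0], the value [p j] is a free row, hence at most [v0], and injectivity makes this
   strict. Otherwise both columns are still free in [A']. *)
move=> i j ij iA jA; have [ii0|ii0] := eqVneq i i0.
  have pj : p j <= v0 by exact: v0max (pnA _ jA).
  rewrite ii0 pi0 ltn_neqAle pj andbT -pi0.
  by apply: contraTneq ij => /val_inj/perm_inj ->; rewrite ii0 ltnn.
apply: pdec => //; rewrite fstA' !inE negb_or ?ii0 ?iA ?jA ?andbT //.
by apply: contraTneq ij => ->; rewrite -leqNgt; exact: i0min.
Qed.

Lemma card_ord_ltn (n x : nat) : x <= n -> #|[set j : 'I_n | j < x]| = x.
Proof.
move=> xn; have inj : injective (widen_ord xn).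
  by move=> i j [ij]; apply: val_inj.
rewrite -[RHS]card_ord -cardsT -(card_imset _ inj).
congr #|pred_of_set _|; apply/setP => j; rewrite inE.
apply/idP/imsetP => [jx|[i _ ->]]; last by rewrite /= ltn_ord.
by exists (Ordinal jx); rewrite ?inE //; apply: val_inj.
Qed.

Lemma muln_add_ord_inj (m a b : nat) (x y : 'I_m) :
  a * m + x = b * m + y -> a = b /\ x = y.
Proof.
have m0 : 0 < m := leq_ltn_trans (leq0n x) (ltn_ord x).
move=> e; have ab : a = b.
  by have := congr1 (divn^~ m) e; rewrite !divnMDl // !divn_small // !addn0.
by split=> //; apply: val_inj; move: e; rewrite ab => /addnI.
Qed.

Lemma leq_muln_add_ord (m a b : nat) (x y : 'I_m) :
  a * m + x <= b * m + y -> a <= b.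
Proof.
have m0 : 0 < m := leq_ltn_trans (leq0n x) (ltn_ord x).
by move=> /(leq_div2r m); rewrite !divnMDl // !divn_small // !addn0.
Qed.

Section Chunks.
Variables (m r : nat) (phi : {ffun 'I_r -> {set 'I_m * 'I_m}}).

(* Column blocks run from left to right and row blocks from bottom to top, so the
   [phi i] descend along an antidiagonal; column block [0] and row block [0] are
   left empty. *)
Definition chunks : {set 'I_(r.+1 * m) * 'I_(r.+1 * m)} :=
  [set z | [exists i, exists x in phi i,
    (val z.1 == i.+1 * m + x.1) && (val z.2 == (r - i) * m + x.2)]].

Lemma chunksP z :
  reflect (exists i x, [/\ x \in phi i, val z.1 = i.+1 * m + x.1 &
    val z.2 = (r - i) * m + x.2]) (z \in chunks).
Proof.
rewrite inE; apply: (iffP existsP) => [[i /existsP[x /and3P[xp /eqP z1 /eqP z2]]]|].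
  by exists i, x.
case=> i [x [xp z1 z2]]; exists i; apply/existsP; exists x.
by rewrite xp z1 z2 !eqxx.
Qed.

Lemma chunk_point (i : 'I_r) (x : 'I_m * 'I_m) :
  exists z : 'I_(r.+1 * m) * 'I_(r.+1 * m),
    val z.1 = i.+1 * m + x.1 /\ val z.2 = (r - i) * m + x.2.
Proof.
have h1 : i.+1 * m + x.1 < r.+1 * m.
  have : i.+1 * m + m <= r.+1 * m by rewrite -mulSnr leq_mul2r !ltnS ltn_ord orbT.
  by have := ltn_ord x.1; lia.
have h2 : (r - i) * m + x.2 < r.+1 * m.
  have : (r - i) * m + m <= r.+1 * m by rewrite -mulSnr leq_mul2r ltnS leq_subr orbT.
  by have := ltn_ord x.2; lia.
by exists (Ordinal h1, Ordinal h2).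
Qed.

Lemma chunks_partial_inj : (forall i, partial_inj (phi i)) -> partial_inj chunks.
Proof.
move=> phiI z w /chunksP[i [x [xp z1 z2]]] /chunksP[j [y [yp w1 w2]]].
rewrite -!val_eqE z1 z2 w1 w2; apply/eqP/eqP => /muln_add_ord_inj[ij /eqP xy].
  have eij : i = j by apply: val_inj; case: ij.
  by subst j; move: xy; rewrite (phiI i _ _ xp yp) => /eqP ->.
have eij : i = j.
  by apply: val_inj; have := ltn_ord i; have := ltn_ord j; move: ij => /=; lia.
by subst j; move: xy; rewrite -(phiI i _ _ xp yp) => /eqP ->.
Qed.

Variable p : 'S_(r.+1 * m).
Hypothesis pE : {in chunks, forall z, p z.1 = z.2}.
Hypothesis pdec : forall i j : 'I_(r.+1 * m), i < j ->
  i \notin fst @: chunks -> j \notin fst @: chunks -> p j < p i.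

Lemma chunk_column (j : 'I_(r.+1 * m)) : j \in fst @: chunks ->
  exists i x, [/\ x \in phi i, val j = i.+1 * m + x.1 &
    val (p j) = (r - i) * m + x.2].
Proof. by move=> /imsetP[z zc ->]; rewrite pE //; exact/chunksP. Qed.

(* Otherwise [p] would inject the columns left of the block of [i], and [i] itself,
   into a set of rows that is smaller by one. *)
Lemma free_column_below (i : 'I_(r.+1 * m)) : i \notin fst @: chunks ->
  p i < (r.+1 - i %/ m) * m.
Proof.
move=> iF; rewrite ltnNge; apply/negP => le_pi.
have m0 := block_size_gt0 i.
set c := i %/ m in le_pi; have cr : c <= r by rewrite -ltnS ltn_divLR.
have ci : c * m <= i by exact: leq_divM.
pose U := i |: [set j : 'I_(r.+1 * m) | j < c * m].
have : #|p @: U| <= #|~: [set v : 'I_(r.+1 * m) | v < (r.+1 - c) * m]|.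
  apply/subset_leq_card/fintype.subsetP => v /imsetP[j jU ->].
  rewrite !inE -leqNgt; move: jU; rewrite !inE => /orP[/eqP -> //|jc].
  have [/chunk_column[i' [x [_ j1 ->]]]|jF] := boolP (j \in fst @: chunks).
    have ic : i'.+1 < c.
      by rewrite -(ltn_pmul2r m0); apply: leq_ltn_trans jc; rewrite j1 leq_addr.
    by apply: leq_trans (leq_addr _ _); rewrite leq_mul2r; apply/orP; right; lia.
  by apply: leq_trans le_pi (ltnW (pdec _ jF iF)); exact: leq_trans ci.
rewrite card_imset; last exact: perm_inj.
rewrite cardsU1 inE -leqNgt ci card_ord_ltn; last by rewrite leq_mul2r ltnW ?orbT.
rewrite cardsCs finset.setCK card_ord card_ord_ltn; last by rewrite leq_mul2r leq_subr orbT.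
by rewrite -mulnBl (subKn (leqW cr)) add1n ltnn.
Qed.

(** Chunk entries to the left of [i] lie in row blocks numbered at least [r.+1 - i %/ m], hence
    above [p i] by [free_column_below]; free columns decrease by hypothesis. *)
Lemma free_column_min (i j : 'I_(r.+1 * m)) : i \notin fst @: chunks ->
  j < i -> p i < p j.
Proof.
move=> iF ji; have [/chunk_column[i' [x [_ j1 ->]]]|jF] := boolP (j \in fst @: chunks);
  last exact: pdec.
have m0 := block_size_gt0 i.
apply: leq_trans (free_column_below iF) (leq_trans _ (leq_addr _ _)).
have : i'.+1 <= i %/ m by rewrite leq_divRL // (leq_trans _ (ltnW ji)) // j1 leq_addr.
by move=> h; rewrite leq_mul2r; apply/orP; right; lia.
Qed.

(** Lets [phi] be read off from [p]: added entries lie strictly below the antidiagonal, so an entry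
    in an antidiagonal block comes from a chunk. *)
Lemma mem_chunkE (i : 'I_r) (x : 'I_m * 'I_m) (c : 'I_(r.+1 * m)) :
  val c = i.+1 * m + x.1 -> (x \in phi i) = (val (p c) == (r - i) * m + x.2).
Proof.
move=> cE; have m0 := block_size_gt0 c.
apply/idP/eqP => [xp|pc].
  have [z [z1 z2]] := chunk_point i x.
  have -> : c = z.1 by apply: val_inj; rewrite cE z1.
  by rewrite pE // ; apply/chunksP; exists i, x.
have cF : c \in fst @: chunks.
  apply/negPn/negP => /free_column_below; rewrite pc cE divnMDl // divn_small // addn0 subSS.
  by rewrite ltnNge leq_addr.
have [i' [y [yp c1 c2]]] := chunk_column cF.
move: c1; rewrite cE => /muln_add_ord_inj[[/val_inj ii'] xy1].
move: c2; rewrite pc -ii' => /muln_add_ord_inj[_ xy2].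
by rewrite ii' (surjective_pairing x) xy1 xy2 -surjective_pairing.
Qed.

Lemma completion_avoids (k : nat) (q : 'S_k) : 0 < k -> indecomposable q ->
  (forall i, ~ has_pattern q (phi i)) -> avoids p (prepend1 q).
Proof.
move=> k0 qI phiq; apply/containsP => -[z [z1 z2 z3]].
pose w a := z (lift ord0 a).
have pz a : p (z a).1 = (z a).2 by apply/eqP; rewrite -mem_graph.
have w1 (a b : 'I_k) : a < b -> (w a).1 < (w b).1.
  by move=> ab; apply: z2; rewrite !lift0 ltnS.
have w2 (a b : 'I_k) : ((w a).2 < (w b).2) = (q a < q b).
  by rewrite z3 /prepend1 !lift_perm_lift !lift0 ltnS.
(* An entry of the copy of [q] has the smaller [z ord0] on its left, so it is no left-to-right
   minimum and its column is not free. *)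
have /fin_all_exists[c /fin_all_exists[x xP]] (a : 'I_k) : exists c : 'I_r, exists x,
    [/\ x \in phi c, val (w a).1 = c.+1 * m + x.1 & val (w a).2 = (r - c) * m + x.2].
  rewrite -pz; apply: chunk_column; apply/negPn/negP => aF.
  have : z ord0 != w a by apply: contraFneq (ltnn (w a).1) => {1}<-; exact: z2.
  have : (z ord0).2 < (w a).2 by rewrite z3 /prepend1 lift_perm_id lift_perm_lift.
  rewrite -!pz ltnNge ltnW // (free_column_min aF) //; exact: z2.
have cC : forall a b, val (c a) = val (c b).
  apply: (indecomposable_const qI) => a b.
    move=> /w1 /ltnW; have [_ -> _] := xP a; have [_ -> _] := xP b.
    exact: leq_muln_add_ord.
  rewrite -w2 => ab; rewrite ltnNge; apply/negP.
  have [_ _ ->] := xP a; have [_ _ ->] := xP b => /leq_muln_add_ord.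
  by have := ltn_ord (c b); move: ab => /=; lia.
pose c0 := c (Ordinal k0).
have {}cC a : c a = c0 by apply/val_inj/cC.
apply: (phiq c0); exists x; split => [a|a b /w1|a b].
- by have [] := xP a; rewrite cC.
- have [_ -> _] := xP a; have [_ -> _] := xP b; by rewrite !cC ltn_add2l.
- rewrite -w2; have [_ _ ->] := xP a; have [_ _ ->] := xP b; by rewrite !cC ltn_add2l.
Qed.

End Chunks.

Definition partial_avoiders (m k : nat) (q : 'S_k) : {set {set 'I_m * 'I_m}} :=
  [set A | `[< partial_inj A /\ ~ has_pattern q A >]].

Lemma partial_avoidersP (m k : nat) (q : 'S_k) (A : {set 'I_m * 'I_m}) :
  reflect (partial_inj A /\ ~ has_pattern q A) (A \in partial_avoiders m q).
Proof. by rewrite /partial_avoiders finset.in_set; exact: asboolP. Qed.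

Lemma nb_avoiders_prepend1_chunks (k : nat) (q : 'S_k) (m r : nat) :
  0 < k -> indecomposable q ->
  #|partial_avoiders m q| ^ r <= nb_avoiders (prepend1 q) (r.+1 * m).
Proof.
move=> k0 qI; pose X := [set phi : {ffun 'I_r -> {set 'I_m * 'I_m}} in
  ffun_on (mem (partial_avoiders m q))].
have -> : #|partial_avoiders m q| ^ r = #|X|.
  by rewrite [RHS]cardsE -[in LHS](card_ord r); apply/esym; exact: card_ffun_on.
have XP phi : phi \in X -> forall i, partial_inj (phi i) /\ ~ has_pattern q (phi i).
  by rewrite finset.in_set => /ffun_onP phiX i; exact/partial_avoidersP/phiX.
have /fin_all_exists[p pP] (phi : {ffun 'I_r -> {set 'I_m * 'I_m}}) :
    exists p : 'S_(r.+1 * m), phi \in X -> {in chunks phi, forall z, p z.1 = z.2} /\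
    forall i j : 'I_(r.+1 * m), i < j ->
      i \notin fst @: chunks phi -> j \notin fst @: chunks phi -> p j < p i.
  (* The identity is a dummy value outside [X], making [p] a total function. *)
  have [phiX|_] := boolP (phi \in X); last by exists 1%g.
  have [|p pP] := @decreasing_completion _ (chunks phi); last by exists p.
  by apply: chunks_partial_inj => i; have [] := XP _ phiX i.
rewrite /nb_avoiders -(card_in_imset (f := p) (D := X)).
  apply/subset_leq_card/fintype.subsetP => _ /imsetP[phi phiX ->].
  have [p1 p2] := pP _ phiX; rewrite finset.in_set.
  by apply: (completion_avoids p1 p2 k0 qI) => i; have [] := XP _ phiX i.
move=> phi psi phiX psiX e; apply/ffunP => i; apply/setP => x.
have [p1 p2] := pP _ phiX; have [p1' p2'] := pP _ psiX.
have [z [z1 _]] := chunk_point i x.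
by rewrite (mem_chunkE p1 p2 z1) (mem_chunkE p1' p2' z1) e.
Qed.

(** * Spreading a permutation over chosen columns and rows *)

Section Scatter.
Variables (m s : nat).

(** These encode the [s]-subsets of ['I_m], with [tnth] as the order embedding. *)
Definition increasing_tuples : {set s.-tuple 'I_m} :=
  [set t : s.-tuple 'I_m | sorted ltn (map val t)].

Definition scatter (d : s.-tuple 'I_m * s.-tuple 'I_m * 'S_s) : {set 'I_m * 'I_m} :=
  [set (tnth d.1.1 a, tnth d.1.2 (d.2 a)) | a in 'I_s].

Lemma ltn_tnth (t : s.-tuple 'I_m) (a b : 'I_s) : t \in increasing_tuples ->
  (tnth t a < tnth t b) = (a < b).
Proof.
rewrite inE => st; have i0 : 'I_m := tnth t a.
have e (c : 'I_s) : val (tnth t c) = nth (val i0) (map val t) c.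
  by rewrite (nth_map i0) ?size_tuple // (tnth_nth i0).
rewrite !e; have lt_s (c : 'I_s) : (c : nat) \in [pred i | i < size (map val t)].
  by rewrite inE size_map size_tuple.
case: (ltngtP a b) => [ab|ba|->]; last by rewrite ltnn.
- by apply: (sorted_ltn_nth ltn_trans).
- by apply/negbTE; rewrite -leqNgt ltnW //; apply: (sorted_ltn_nth ltn_trans).
Qed.

Lemma tnth_increasing_inj (t : s.-tuple 'I_m) : t \in increasing_tuples ->
  injective (tnth t).
Proof.
move=> st a b e; case: (ltngtP a b) => [| |/val_inj //];
  by rewrite -(ltn_tnth _ _ st) e ltnn.
Qed.

Lemma increasing_tuples_eq (t u : s.-tuple 'I_m) : t \in increasing_tuples ->
  u \in increasing_tuples -> t =i u -> t = u.
Proof.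
rewrite !inE => st su tu; apply/val_inj/(inj_map val_inj).
apply: (irr_sorted_eq ltn_trans ltnn st su) => x.
by apply/mapP/mapP => -[y yt ->]; exists y => //; rewrite ?tu // -tu.
Qed.

(** The occupied columns and rows of the image determine the two increasing tuples, and then the
    points determine the permutation. *)
Lemma scatter_inj (q : pred 'S_s) :
  {in [set d | [&& d.1.1 \in increasing_tuples, d.1.2 \in increasing_tuples & q d.2]] &,
    injective scatter}.
Proof.
move=> [[t u] b] [[t' u'] b']; rewrite finset.in_set => /and3P[/= st su _].
rewrite finset.in_set => /and3P[/= st' su' _] e.
have fstE (t1 u1 : s.-tuple 'I_m) b1 x : x \in t1 = (x \in fst @: scatter (t1, u1, b1)).
  apply/tnthP/imsetP => [[a ->]|[_ /imsetP[a _ ->] ->]]; last by exists a.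
  by exists (tnth t1 a, tnth u1 (b1 a)) => //; apply/imsetP; exists a.
have sndE (t1 u1 : s.-tuple 'I_m) b1 x : x \in u1 = (x \in snd @: scatter (t1, u1, b1)).
  apply/tnthP/imsetP => [[a ->]|[_ /imsetP[a _ ->] ->]]; last by exists (b1 a).
  exists (tnth t1 (b1^-1%g a), tnth u1 a) => //.
  by apply/imsetP; exists (b1^-1%g a); rewrite //= permKV.
have tt' : t = t'.
  by apply: (increasing_tuples_eq _ _) => // x; rewrite (fstE t u b) e -fstE.
have uu' : u = u'.
  by apply: (increasing_tuples_eq _ _) => // x; rewrite (sndE t u b) e -sndE.
rewrite -tt' -uu' in e *; congr pair; apply/permP => a.
have : (tnth t a, tnth u (b a)) \in scatter (t, u, b') by rewrite -e; apply/imsetP; exists a.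
by move=> /imsetP[a' _ [/(tnth_increasing_inj st) -> /(tnth_increasing_inj su)]].
Qed.

Lemma scatter_avoids (k : nat) (q : 'S_k) d : d.1.1 \in increasing_tuples ->
  d.1.2 \in increasing_tuples -> avoids d.2 q -> scatter d \in partial_avoiders m q.
Proof.
case: d => [[t u] b] /= st su bq; apply/partial_avoidersP; split.
  move=> _ _ /imsetP[a _ ->] /imsetP[a' _ ->] /=.
  by rewrite !(inj_eq (tnth_increasing_inj _)) // (inj_eq perm_inj).
case=> z [z1 z2 z3]; move: bq => /containsP; apply.
have /fin_all_exists[y yz] a : exists y, z a = (tnth t y, tnth u (b y)).
  by have /imsetP[y _ ->] := z1 a; exists y.
exists (fun a => (y a, b (y a))); split => [a|a a'|a a'] /=.
- by rewrite mem_graph.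
- by move=> /z2; rewrite !yz /= (ltn_tnth _ _ st).
- by rewrite -z3 !yz /= (ltn_tnth _ _ su).
Qed.

Lemma card_partial_avoiders (k : nat) (q : 'S_k) :
  'C(m, s) ^ 2 * nb_avoiders q s <= #|partial_avoiders m q|.
Proof.
have Ct : #|increasing_tuples| = 'C(m, s) by exact: card_ltn_sorted_tuples.
rewrite -Ct expnS expn1 /nb_avoiders -!cardsX.
rewrite (_ : finset.setX _ _ = [set d | [&& d.1.1 \in increasing_tuples,
  d.1.2 \in increasing_tuples & avoids d.2 q]]); last first.
  apply/setP => -[[t u] b]; rewrite [RHS]finset.in_set !finset.in_setX /=.
  by rewrite [b \in _]finset.in_set andbA.
rewrite -(card_in_imset (@scatter_inj (fun b => avoids b q))).
apply/subset_leq_card/fintype.subsetP => A /imsetP[d]; rewrite finset.in_set.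
by move=> /and3P[h1 h2 h3] ->; exact: scatter_avoids.
Qed.

End Scatter.

(** * Growth rates *)

Lemma nb_avoiders_homo (k : nat) (q : 'S_k) (m n : nat) :
  1 < k -> indecomposable q -> m <= n -> nb_avoiders q m <= nb_avoiders q n.
Proof.
move=> k1 qI mn; rewrite -(subnKC mn).
apply: leq_trans (nb_avoiders_supermul _ _ (ltnW k1) qI).
by rewrite leq_pmulr // nb_avoiders_gt0.
Qed.

Lemma nb_avoiders_exp_bound (k : nat) (q : 'S_k) : 1 < k -> indecomposable q ->
  exists C, forall n, nb_avoiders q n <= C ^ n.
Proof.
move=> k1 qI; have [C hC] := nb_avoiders_exp_bound_pow q k1.
set K := k ^ 2 in hC.
have K1 : 1 < K by rewrite (leq_trans k1) // /K expnS expn1 leq_pmull // ltnW.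
have C0 : 0 < C.
  by have := leq_trans (nb_avoiders_gt0 _ k1 qI) (hC 0); rewrite expn0 expn1.
(* By monotonicity one may pass to the next power of [K], which is at most [K] times the length.
   [up_log_bounds] requires a length above 1. *)
exists (C ^ K) => -[|[|n]].
- by rewrite (leq_trans (max_card _)) // card_Sn.
- rewrite expn1 (leq_trans (hC 0)) // leq_pexp2l // expn0; exact: ltnW.
have /andP[lo hi] := @up_log_bounds K n.+2 K1 isT.
apply: leq_trans (nb_avoiders_homo k1 qI hi) _; apply: leq_trans (hC _) _.
rewrite -expnM leq_pexp2l //.
have e0 : 0 < up_log K n.+2 by rewrite up_log_gt0 K1.
by rewrite -(prednK e0) expnS leq_mul2l (ltnW lo) orbT.
Qed.

Lemma nb_avoiders1 (q : 'S_1) (n : nat) : 0 < n -> nb_avoiders q n = 0.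
Proof.
move=> n0; apply/eqP; rewrite cards_eq0; apply/eqP/setP => p; rewrite !finset.in_set.
apply/negbTE; rewrite negbK; apply/containsP.
exists (fun=> (Ordinal n0, p (Ordinal n0))); split => [a|a b|a b] /=.
- by rewrite mem_graph.
- by rewrite !ord1.
- by rewrite !ord1 !ltnn.
Qed.

Local Open Scope classical_set_scope.
Local Open Scope ring_scope.

(** * Convergence of roots and comparison of exponentials *)

Section Growth.
Variable R : realType.
Implicit Types (x y K : R).

Lemma bernoulli_ge (h : R) (n : nat) : 0 <= h -> 1 + n%:R * h <= (1 + h) ^+ n.
Proof.
move=> h0; elim: n => [|n IH]; first by rewrite mul0r addr0 expr0.
rewrite exprS; apply: le_trans (ler_wpM2l _ IH); last by lra.
have : 0 <= n%:R * h * h by rewrite !mulr_ge0.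
rewrite -natr1; lra.
Qed.

Lemma expr_eventually_ge x K : 1 < x ->
  exists N, forall n, (N <= n)%N -> K <= x ^+ n.
Proof.
move=> x1; pose h := x - 1; have h0 : 0 < h by rewrite subr_gt0.
have K0 : 0 <= `|K| / h by rewrite divr_ge0 // ltW.
exists (Num.bound (`|K| / h)) => n Nn.
have -> : x = 1 + h by rewrite /h; lra.
apply: le_trans (bernoulli_ge n (ltW h0)).
have : `|K| / h <= n%:R.
  by apply: le_trans (ltW (archi_boundP K0)) _; rewrite ler_nat.
rewrite ler_pdivrMr // => le_nh.
by have := ler_norm K; lra.
Qed.

Lemma le_of_expr_le x y K : 0 < y -> (forall n, x ^+ n <= K * y ^+ n) -> x <= y.
Proof.
move=> y0 xyK; rewrite leNgt; apply/negP => yx.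
have [|N /(_ N (leqnn N))] := @expr_eventually_ge (x / y) (K + 1).
  by rewrite ltr_pdivlMr // mul1r.
rewrite expr_div_n ler_pdivlMr ?exprn_gt0 // => h.
have := le_trans h (xyK N); rewrite ler_pM2r ?exprn_gt0 //; lra.
Qed.

Lemma root_exprK (A : nat) (n : nat) : (0 < n)%N ->
  (A%:R `^ n%:R^-1 : R) ^+ n = A%:R.
Proof.
move=> n0; rewrite -powR_mulrn ?powR_ge0 // -powRrM mulVf ?powRr1 //.
by rewrite pnatr_eq0 -lt0n.
Qed.

Lemma le_root x (A n : nat) : (0 < n)%N -> 0 <= x ->
  (x <= A%:R `^ n%:R^-1) = (x ^+ n <= A%:R).
Proof.
by move=> n0 x0; rewrite -{2}(root_exprK A n0) ler_pXn2r // nnegrE ?powR_ge0.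
Qed.

Lemma root_le x (A n : nat) : (0 < n)%N -> 0 <= x ->
  (A%:R `^ n%:R^-1 <= x) = (A%:R <= x ^+ n).
Proof.
by move=> n0 x0; rewrite -{2}(root_exprK A n0) ler_pXn2r // nnegrE ?powR_ge0.
Qed.

(** Fekete's lemma in multiplicative form: the limit is the supremum of the roots, which [C]
    bounds. *)
Lemma fekete_root_cvg (a : nat -> nat) (C : nat) :
  (forall n, (0 < a n)%N) -> (forall n, (a n <= C ^ n)%N) ->
  (forall m n, (a m * a n <= a (m + n))%N) ->
  exists G : R, [/\ (a n)%:R `^ (n%:R^-1) @[n --> \oo] --> G, 1 <= G &
    forall n, (0 < n)%N -> (a n)%:R <= G ^+ n].
Proof.
move=> a0 aC aM; pose x n : R := (a n)%:R `^ n%:R^-1.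
pose E := [set x n.+1 | n in [set: nat]].
have x1 n : (0 < n)%N -> 1 <= x n.
  by move=> n0; rewrite le_root // expr1n ler1n.
have Eub : has_sup E.
  split; first by exists (x 1%N); exists 0%N.
  exists C%:R => _ [n _ <-]; rewrite root_le //.
  by rewrite -natrX ler_nat.
pose G := sup E.
have xG n : (0 < n)%N -> x n <= G.
  by case: n => // n _; apply: ub_le_sup (Eub.2) _ _; exists n.
have G1 : 1 <= G := le_trans (x1 1%N isT) (xG 1%N isT).
have G0 : 0 <= G := le_trans ler01 G1.
exists G; split => //; last by move=> n n0; rewrite -root_le //; exact: xG.
(* Divide [n] by [m]: supermultiplicativity handles the quotient, and the remainder costs at most a
   factor [a m] since [1 <= x m]. *)
have growth m n : (0 < m)%N -> x m ^+ n <= (a m)%:R * (a n)%:R.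
  move=> m0; rewrite {1}(divn_eq n m) exprD mulnC exprM root_exprK //.
  have le_pow j l : ((a m) ^ j * a l <= a (j * m + l))%N.
    elim: j => [|j IH]; first by rewrite mul1n.
    rewrite expnS -mulnA mulSn -addnA; apply: leq_trans (aM _ _).
    by rewrite leq_mul2l IH orbT.
  have h1 : x m ^+ (n %% m) <= (a m)%:R.
    by rewrite -(root_exprK (a m) m0) ler_weXn2l ?x1 // ltnW // ltn_mod.
  rewrite mulrC ler_pM ?exprn_ge0 ?powR_ge0 //.
  rewrite -natrX ler_nat {2}(divn_eq n m).
  by apply: leq_trans (le_pow _ _); rewrite leq_pmulr.
apply/cvgrPdist_le => e e0.
have e2 : 0 < e / 2 by rewrite divr_gt0.
have [_ [m _ <-] Gm] := sup_adherent e2 Eub.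
have [y0|y0] := leP (G - e) 0.
  near=> n; have n0 : (0 < n)%N by near: n; exists 1%N.
  rewrite ger0_norm ?subr_ge0 ?xG // lerBlDr.
  have : 0 <= x n by exact: powR_ge0.
  rewrite /x; lra.
(* As [x m.+1] exceeds [G - e], the powers of the ratio eventually absorb the constant [a m.+1] of
   [growth]. *)
have [|N hN] := @expr_eventually_ge (x m.+1 / (G - e)) (a m.+1)%:R.
  rewrite ltr_pdivlMr // mul1r; apply: lt_trans Gm; rewrite -/G; lra.
near=> n; have n0 : (0 < n)%N by near: n; exists 1%N.
rewrite ger0_norm ?subr_ge0 ?xG // lerBlDr -lerBlDl le_root ?(ltW y0) //.
have Nn : (N <= n)%N by near: n; exists N.
have := hN n Nn; rewrite expr_div_n ler_pdivlMr ?exprn_gt0 // => h.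
have := le_trans h (growth m.+1 n isT); rewrite ler_pM2l // ltr0n //.
Unshelve. all: by end_near.
Qed.

(** With [(1 + d) * y = y + e], Bernoulli's inequality gives [n.+1 <= (1 + d^-1) * (1 + d) ^+ n], so
    the linear factor costs only a constant and the arbitrarily small [e]. *)
Lemma le_of_expr_le_linear x y K : 0 < y ->
  0 <= K -> (forall n, x ^+ n <= n.+1%:R * (K * y ^+ n)) -> x <= y.
Proof.
move=> y0 K0 xy; apply/ler_addgt0Pr => e e0; pose d := e / y.
have d0 : 0 < d by rewrite divr_gt0.
have -> : y + e = (1 + d) * y by rewrite /d; field; rewrite gt_eqF.
apply: (@le_of_expr_le _ _ ((1 + d^-1) * K)); first by rewrite mulr_gt0 // addr_gt0.
move=> n; apply: le_trans (xy n) _; rewrite exprMn.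
have -> : (1 + d^-1) * K * ((1 + d) ^+ n * y ^+ n) =
  ((1 + d^-1) * (1 + d) ^+ n) * (K * y ^+ n) by ring.
rewrite ler_wpM2r ?mulr_ge0 ?exprn_ge0 // ?(ltW y0) //.
have dV : 0 < 1 + d^-1 by rewrite addr_gt0 ?invr_gt0.
apply: le_trans (ler_wpM2l (ltW dV) (bernoulli_ge n (ltW d0))).
have -> : (1 + d^-1) * (1 + n%:R * d) = n.+1%:R + d^-1 + n%:R * d.
  by rewrite -natr1; field; rewrite gt_eqF.
have : 0 <= n%:R * d by rewrite mulr_ge0 // ltW.
by move: d0; rewrite -invr_gt0; lra.
Qed.

(* Compare with the binomial expansion of [(1 + w) ^+ m]. *)
Lemma binomial_growth (G w K : R) (S : nat -> nat) :
  0 < G -> 0 <= w -> 0 <= K ->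
  (forall s, w ^+ (s * 2) <= K * (S s)%:R) ->
  (forall m s, (s <= m)%N -> ('C(m, s) ^ 2 * S s)%:R <= G ^+ m) ->
  1 + w <= Num.sqrt G.
Proof.
move=> G0 w0 K0 wS SG; have g0 : 0 < Num.sqrt G by rewrite sqrtr_gt0.
apply: (@le_of_expr_le_linear _ _ (Num.sqrt K)) => // m.
rewrite exprDn mulr_natl -[m.+1 in leRHS]card_ord -sumr_const.
apply: ler_sum => s _; rewrite expr1n mul1r -mulr_natr.
(* Each of the [m.+1] terms is bounded after squaring: ['C(m, s) ^ 2 * w ^ (2 * s)] is at most
   [K * 'C(m, s) ^ 2 * S s], hence at most [K * G ^ m]. *)
rewrite -(@ler_pXn2r _ 2) ?nnegrE ?mulr_ge0 ?exprn_ge0 ?sqrtr_ge0 //.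
rewrite [leRHS]exprMn -exprM mulnC exprM !sqr_sqrtr ?(ltW G0) // exprMn -exprM.
apply: le_trans (ler_wpM2r _ (wS s)) _; first by rewrite exprn_ge0.
by rewrite -mulrA ler_wpM2l // mulrC -natrX -natrM SG // -ltnS.
Qed.

End Growth.

Theorem theorem5p5 (R : realType) (k : nat) (hk : (0 < k)%N) (q : 'S_k)
    (hq : indecomposable q) (L : R)
    (hL : root_avoiders R q n @[n --> \oo] --> L) :
  cvg (root_avoiders R (prepend1 q) n @[n --> \oo]) /\
  1 + L + 2 * Num.sqrt L <= lim (root_avoiders R (prepend1 q) n @[n --> \oo]).
Proof.
have q'I := prepend1_indecomposable q.
have [C hC] := @nb_avoiders_exp_bound k.+1 _ hk q'I.
have [||G [cvgG G1 aG]] := @fekete_root_cvg R (nb_avoiders (prepend1 q)) C _ hC.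
- by move=> n; exact: nb_avoiders_gt0.
- by move=> m n; exact: nb_avoiders_supermul.
split; first by apply/cvg_ex; exists G.
rewrite (cvg_lim _ cvgG) //.
(* For [L <= 0] the square root is 0 and [1 <= G] suffices. *)
have [L0|L0] := leP L 0; first by rewrite (ler0_sqrtr L0); lra.
have G0 : 0 < G := lt_le_trans ltr01 G1.
have rootL y : y < L -> exists N, forall n, (N <= n)%N -> y <= root_avoiders R q n.
  move=> yL; have := cvgr_ge _ hL _ yL.
  by case=> N _ hN; exists N => n /hN.
have k1 : (1 < k)%N.
  (* For [k = 1] all roots of positive index vanish, contradicting [0 < L]. *)
  rewrite ltn_neqAle hk andbT; apply/eqP => k1.
  subst k; have [|N /(_ N.+1 (leqnSn N))] := rootL (L / 2); first by lra.
  by rewrite /root_avoiders nb_avoiders1 // powR0 ?invr_neq0 ?pnatr_eq0 //; lra.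
have bound w : 0 < w -> w < Num.sqrt L -> 1 + w <= Num.sqrt G.
  move=> w0 wL; have [|N hN] := rootL (w ^+ 2).
    by rewrite -(sqr_sqrtr (ltW L0)) ltr_pXn2r // nnegrE ?sqrtr_ge0 // ltW.
  have w2 : 1 <= 1 + w ^+ 2 by rewrite lerDl sqr_ge0.
  have S1 s : 1 <= (nb_avoiders q s)%:R :> R by rewrite ler1n nb_avoiders_gt0.
  (* From [N] on, [S_s(q)] is at least [w ^ (2 * s)]; the constant absorbs the smaller [s], where
     [S_s(q) >= 1]. *)
  apply: (@binomial_growth _ _ _ ((1 + w ^+ 2) ^+ N.+1) (nb_avoiders q)) => //.
  - exact: ltW.
  - by rewrite exprn_ge0 // (le_trans ler01).
  - move=> s; rewrite mulnC exprM; have [sN|Ns] := leqP s N.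
      apply: le_trans (_ : (1 + w ^+ 2) ^+ N.+1 <= _); last first.
        by rewrite ler_peMr // exprn_ge0 // (le_trans ler01).
      apply: le_trans (_ : (1 + w ^+ 2) ^+ s <= _).
        by rewrite lerXn2r ?nnegrE ?sqr_ge0 ?lerDr // (le_trans ler01).
      by rewrite ler_weXn2l // leqW.
    have s0 : (0 < s)%N by exact: leq_ltn_trans Ns.
    have := hN s (ltnW Ns); rewrite le_root ?sqr_ge0 // => h.
    by apply: le_trans h _; rewrite ler_peMl ?exprn_ege1.
  - move=> m s sm; apply: le_trans (_ : #|partial_avoiders m q|%:R <= _).
      by rewrite ler_nat card_partial_avoiders.
    have [->|m0] := posnP m.
      rewrite expr0 lern1 (leq_trans (max_card _)) // -cardsT -powersetT.
      by rewrite card_powerset cardsT card_prod card_ord.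
    (* The extra block of length [m] costs the constant factor [G ^+ m], which disappears as [r]
       grows. *)
    apply: (@le_of_expr_le _ _ _ (G ^+ m)); first by rewrite exprn_gt0.
    move=> r; rewrite -!exprM -exprD -natrX -mulnS mulnC.
    apply: le_trans (aG _ _); last by rewrite muln_gt0.
    by rewrite ler_nat nb_avoiders_prepend1_chunks.
have gL : Num.sqrt L <= Num.sqrt G - 1.
  rewrite leNgt; apply/negP => h.
  have g1 : 1 <= Num.sqrt G by rewrite -(sqrtr1 R) ler_wsqrtr.
  (* The midpoint is positive, below [Num.sqrt L] and above [Num.sqrt G - 1], which contradicts
     [bound]. *)
  have := bound ((Num.sqrt G - 1 + Num.sqrt L) / 2); lra.
rewrite -{1}(sqr_sqrtr (ltW L0)) -(sqr_sqrtr (ltW G0)).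
by have := sqrtr_ge0 L; nra.
Qed.
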